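(* For each positive integer $N$ there exists a finite list of classes of positive integers together with residues modulo $2^N$ attached to them, with the following properties. Each class is of the form $$\{\,2^{k_1}+2^{k_2}+\cdots+2^{k_\ell}-2^{N-1}\ :\ (k_1,\ldots,k_\ell)\ \text{satisfies } \mathcal{R}\,\}$$ for some $\ell\ge1$ and some finite system $\mathcal{R}$ of relations, each of the form $k_i=k_{i+1}+d_i$ or $k_i\geq k_{i+1}+d_i$ for fixed positive integers $d_i$ (together with a lower bound on the smallest exponent), there being only finitely many such systems; every element $n$ of a class satisfies $s_2(n+2^{N-1})<2^{N}$; for every $n$ in a class, $\mathrm{v}(n)$ modulo $2^N$ equals the residue attached to that class (which depends only on $\ell$ and the system $\mathcal{R}$); and for every positive integer $n$ belonging to none of the classes, $\mathrm{v}(n)\equiv 0\pmod{2^{N}}$.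
   Context: For a positive integer $n$, $\mathrm{v}(n)$ denotes the number of compositions (ordered partitions) of $n$ into powers of $2$, i.e. the number of finite sequences $(q_1,\ldots,q_\ell)$ of non-negative integers with $n=2^{q_1}+\cdots+2^{q_\ell}$. For a positive integer $m$, $s_2(m)$ denotes the number of $1$'s in the binary expansion of $m$. (Example for $N=2$: for $n\ge 2$, $\mathrm{v}(n)\equiv 2 \pmod 4$ if $n=2^k+2^l+2^m-2$ with $k>l>m\ge1$, or $n=2^k-2$ with $k\ge2$, or $n=3\cdot 2^k-2$ with $k\ge1$, or $n=2^k+2^l-1$ with $k>l\ge1$; $\mathrm{v}(n)\equiv 3\pmod 4$ if $n=2^k-1$ with $k\ge 2$; and $\mathrm{v}(n)\equiv 0 \pmod 4$ otherwise.)
   Formalization: The condition on the smallest exponent may be an equality k_ℓ = c as well as a lower bound k_ℓ ≥ c; with lower bounds alone the claim fails for N ≥ 2 (v(2^k−1) ≡ 3 but v(2^{k+1}) ≡ 0 mod 4). *)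

(* Defs.v *)
From mathcomp Require Import all_boot.

Set Implicit Arguments.
Unset Strict Implicit.
Unset Printing Implicit Defensive.

(* The bounds l <= n and q_i < n lose nothing: every part is at least 1, and
   2 ^ q <= n forces q < n; see vP. *)
Definition v (n : nat) : nat :=
  \sum_(l < n.+1) #|[set q : l.-tuple 'I_n | \sum_(i < l) 2 ^ tnth q i == n]|.

(* Bits of index i >= m of m vanish, since m < 2 ^ m. *)
Definition s2 (m : nat) : nat := \sum_(i < m) odd (m %/ 2 ^ i).

Variant shift := Exactly of nat | AtLeast of nat.

Definition amount (r : shift) : nat :=
  match r with Exactly d => d | AtLeast d => d end.

(* x = y + d, respectively x >= y + d *)
Definition holds (r : shift) (x y : nat) : bool :=
  match r with Exactly d => x == y + d | AtLeast d => y + d <= x end.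

(* A system of relations on (k_1, ..., k_l) with l = (size gaps).+1: the entries
   of gaps relate k_i to k_(i+1), and bottom constrains the smallest exponent
   k_l, as k_l = c or k_l >= c.  The case k_l = c is needed already modulo 4:
   v n = 3 %[mod 4] for n = 2 ^ k - 1 = 2 ^ k + 2 ^ 0 - 2 with k >= 2, whereas
   v n = 0 %[mod 4] for n = 2 ^ k = 2 ^ k + 2 ^ 1 - 2 with k >= 3. *)
Record system := System { gaps : seq shift; bottom : shift }.

Definition admissible (R : system) : bool :=
  all (fun r => 0 < amount r) (gaps R).

Definition satisfies (R : system) (k : seq nat) : Prop :=
  [/\ size k = (size (gaps R)).+1,
      forall i, i < size (gaps R) ->
        holds (nth (bottom R) (gaps R) i) (nth 0 k i) (nth 0 k i.+1)
    & holds (bottom R) (last 0 k) 0].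

(* The subtraction is truncated: a tuple k whose value is not a positive integer
   contributes n = 0. *)
Definition in_class (N : nat) (R : system) (n : nat) : Prop :=
  exists2 k : seq nat, satisfies R k & n = \sum_(j <- k) 2 ^ j - 2 ^ N.-1.

Lemma vP (n : nat) :
  exists s : seq (seq nat),
    [/\ uniq s, size s = v n
      & forall q : seq nat, (q \in s) = (\sum_(j <- q) 2 ^ j == n)].
Proof.
pose A l := [set q : l.-tuple 'I_n | \sum_(i < l) 2 ^ tnth q i == n].
pose F l := [seq map (@nat_of_ord n) (tval q) | q <- enum (A l)].
have szF l q : q \in F l -> size q = l.
  by case/mapP=> t _ ->; rewrite size_map size_tuple.
have uF l : uniq (F l).
  rewrite map_inj_uniq ?enum_uniq // => t u /(inj_map (@ord_inj n)).
  exact: val_inj.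
exists (flatten [seq F l | l <- iota 0 n.+1]); split.
- elim: (n.+1) 0 => //= m IHm a; rewrite cat_uniq uF IHm andbT /=.
  apply/hasPn=> q /flatten_mapP[l]; rewrite mem_iota => /andP[al _] qF.
  by apply/negP=> /szF sq; move: al; rewrite -(szF _ _ qF) sq ltnn.
- rewrite size_flatten /shape -map_comp sumnE big_map.
  rewrite -[iota 0 _]/(index_iota 0 n.+1) big_mkord.
  by apply: eq_bigr => l _ /=; rewrite size_map -cardE.
move=> q; apply/flatten_mapP/eqP => [[l _ /mapP[t]]|sq].
  by rewrite mem_enum inE => /eqP tn ->; rewrite big_map big_tuple.
have lq : size q <= n.
  rewrite -sq -sum1_size.
  by apply: leq_sum => j _; rewrite expn_gt0.
have qn j : j \in q -> j < n.
  move=> jq; apply: leq_trans (ltn_expl j (isT : 1 < 2)) _.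
  by rewrite -sq (big_rem j) //= leq_addr.
exists (size q); first by rewrite mem_iota.
have qE : map (@nat_of_ord n) (pmap insub q) = q.
  rewrite (pmap_filter (@insubK _ _ _)); apply/all_filterP/allP => j jq.
  by rewrite isSome_insub qn.
have szt : size (pmap (insub : nat -> option 'I_n) q) == size q.
  by rewrite -{2}qE size_map.
apply/mapP; exists (Tuple szt) => //.
rewrite mem_enum inE; apply/eqP; rewrite -[RHS]sq -[in RHS]qE big_map.
by rewrite -[pmap _ _]/(tval (Tuple szt)) big_tuple.
Qed.

(* Main.v *)
Require Import Defs.
From mathcomp Require Import all_boot all_algebra.
From mathcomp Require Import zify ring.

(** Let P be the power series of all X ^ (2 ^ q), so that the v n are the
    coefficients of 1 / (1 - P), and let M = 2 ^ (N - 1).  Since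
    P (1 - P) = X modulo 2, we have (P (1 - P)) ^ M = X ^ M modulo 2 ^ N, hence
    X ^ M / (1 - P) = P ^ M (1 - P) ^ (M - 1) modulo 2 ^ N.  Thus v n modulo
    2 ^ N is a fixed combination of the numbers of compositions of n + M into
    exactly j powers of 2, for j < 2 ^ N.  Such a composition needs
    s2 (n + M) <= j parts, and with so few parts no carry can cross a long run
    of zeros of the binary expansion of n + M, so that the count depends only
    on the gaps between the binary exponents, truncated at 2 ^ N + 1. *)

Set Implicit Arguments.
Unset Strict Implicit.
Unset Printing Implicit Defensive.

Import GRing.Theory.

(** * Power series and the congruence for [v] modulo 2 ^ N *)

Section PowerSeries.

Local Open Scope ring_scope.

Lemma coefXD_high (R : comNzRingType) (p h : {poly R}) (t j m : nat) :
  (m < t)%N -> ((p + 'X^t * h) ^+ j)`_m = (p ^+ j)`_m.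
Proof.
move=> mt; apply/eqP; rewrite -subr_eq0 -coefB subrXX addrAC subrr add0r.
by rewrite -mulrA coefXnM mt.
Qed.

Definition pow2sum (K : nat) : {poly int} := \sum_(q < K) 'X^(2 ^ q).

(* The number of compositions of m into j powers of 2: the exponents q >= m
   play no role, since m < 2 ^ m. *)
Definition ncomp (j m : nat) : int := (pow2sum m ^+ j)`_m.

Lemma pow2sumSr (K : nat) : pow2sum K.+1 = pow2sum K + 'X^(2 ^ K).
Proof. by rewrite /pow2sum big_ord_recr. Qed.

Lemma pow2sumSl (K : nat) : pow2sum K.+1 = 'X + (pow2sum K \Po 'X^2).
Proof.
rewrite /pow2sum big_ord_recl raddf_sum; congr (_ + _).
apply: eq_bigr => i _.
by rewrite /= comp_Xn_poly -exprM -expnS.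
Qed.

Lemma coef_pow2sumX_widen (K d j m : nat) :
  (m < 2 ^ K)%N -> (pow2sum (K + d) ^+ j)`_m = (pow2sum K ^+ j)`_m.
Proof.
move=> mK; elim: d => [|d IHd]; first by rewrite addn0.
rewrite addnS pow2sumSr -['X^_]mulr1 coefXD_high //.
by rewrite (leq_trans mK) // leq_exp2l // leq_addr.
Qed.

Lemma coef_pow2sumX (K j m : nat) :
  (m < 2 ^ K)%N -> (pow2sum K ^+ j)`_m = ncomp j m.
Proof.
move=> mK; rewrite /ncomp; case: (leqP m K) => mK'.
  by rewrite -(subnKC mK') coef_pow2sumX_widen // ltn_expl.
by rewrite -(subnKC (ltnW mK')) coef_pow2sumX_widen // subnKC // ltnW.
Qed.

(* z is the number of parts equal to 1; the other parts are halved. *)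
Lemma ncomp_rec (j m : nat) :
  ncomp j m = \sum_(z < j.+1 | (z <= m)%N && ~~ odd (m - z))
                 ncomp (j - z) (m - z)./2 *+ 'C(j, z).
Proof.
rewrite -(@coef_pow2sumX m.+1) ?(ltn_trans _ (ltn_expl m.+1 _)) //.
rewrite pow2sumSl addrC exprDn coef_sum [RHS]big_mkcond.
apply: eq_bigr => z _; rewrite coefMn coefMXn ltnNge.
case: leqP => //= zm; last by rewrite mul0rn.
rewrite -rmorphXn /= coef_comp_poly_Xn // dvdn2.
case: ifP => _; last by rewrite mul0rn.
rewrite divn2 coef_pow2sumX //.
by apply: leq_ltn_trans (ltn_expl m (isT : (1 < 2)%N)); lia.
Qed.

Lemma v_sum_ncomp (n : nat) : (v n)%:Z = \sum_(l < n.+1) ncomp l n.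
Proof.
rewrite /v -natz natr_sum; apply: eq_bigr => l _.
(* Expanding the power by distributivity gives one monomial for each choice of l exponents. *)
rewrite /ncomp -[in RHS](card_ord l) -prodr_const bigA_distr_bigA coef_sum.
have -> : \sum_(f : {ffun 'I_l -> 'I_n}) (\prod_(i < l) 'X^(2 ^ f i))`_n
   = (\sum_(f : {ffun 'I_l -> 'I_n}) (\sum_(i < l) 2 ^ f i == n)%N)%:R :> int.
  rewrite natr_sum; apply: eq_bigr => f _.
  by rewrite -expr_sum coefXn eq_sym.
congr (_%:R); rewrite cardsE -sum1_card big_mkcond.
rewrite (reindex (fun f : {ffun 'I_l -> 'I_n} => [tuple f i | i < l])).
  apply: eq_bigr => f _; rewrite unfold_in /=.
  under eq_bigr do rewrite tnth_mktuple.
  by rewrite eqnE; case: (_ == _).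
exists (fun t : l.-tuple 'I_n => [ffun i => tnth t i]) => [f _|t _].
  by apply/ffunP=> i; rewrite ffunE tnth_mktuple.
by apply: eq_from_tnth => i; rewrite tnth_mktuple ffunE.
Qed.

(** Each squaring gains a factor of 2: the cross term is doubled, and the square of the error term
    is divisible by an even higher power. *)
Lemma expr2X_congr (R : comNzRingType) (a b : R) (k : nat) :
  exists c, (a + b *+ 2) ^+ (2 ^ k) = a ^+ (2 ^ k) + c *+ (2 ^ k.+1).
Proof.
elim: k => [|k [c IHk]]; first by exists b; rewrite expn0 !expr1.
exists (a ^+ (2 ^ k) * c + c ^+ 2 *+ 2 ^ k).
have sqE (x : R) : x ^+ (2 ^ k.+1) = (x ^+ (2 ^ k)) ^+ 2.
  by rewrite expnSr exprM.
rewrite !sqE IHk (expnS 2 k.+1) (expnS 2 k).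
by move: (2 ^ k)%N (a ^+ _) => p x; ring.
Qed.

(** Modulo 2, squaring [pow2sum K] doubles every exponent, so the difference telescopes; truncation
    leaves the term ['X^(2 ^ K)]. *)
Lemma sqr_pow2sum (K : nat) :
  exists E : {poly int},
    pow2sum K * (1 - pow2sum K) = 'X - 'X^(2 ^ K) + E *+ 2.
Proof.
elim: K => [|K [E IHK]].
  by exists 0; rewrite /pow2sum big_ord0 expn0 expr1; ring.
exists (E - pow2sum K * 'X^(2 ^ K)).
have -> : pow2sum K.+1 * (1 - pow2sum K.+1) =
  pow2sum K * (1 - pow2sum K) + 'X^(2 ^ K) - 'X^(2 ^ K) ^+ 2
   - pow2sum K * 'X^(2 ^ K) *+ 2.
  by rewrite pow2sumSr; move: 'X^(2 ^ K) => x; ring.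
rewrite IHK -exprM -expnSr.
by move: 'X^(2 ^ K) 'X^(2 ^ K.+1) => x y; ring.
Qed.

Lemma pow2sum_lowX (K j m : nat) : (m < j)%N -> (pow2sum K ^+ j)`_m = 0.
Proof.
suff [h ->] : exists h, pow2sum K = 'X * h.
  by move=> mj; rewrite exprMn coefXnM mj.
exists (\sum_(q < K) 'X^((2 ^ q).-1)); rewrite mulr_sumr.
by apply: eq_bigr => q _; rewrite -exprS prednK // expn_gt0.
Qed.

Lemma v_congr_ncomp (N n : nat) : (0 < N)%N ->
  exists c : int,
    (v n)%:Z = \sum_(i < 2 ^ N.-1)
        (-1) ^+ i * ncomp (2 ^ N.-1 + i) (n + 2 ^ N.-1) *+ 'C((2 ^ N.-1).-1, i)
      + c *+ (2 ^ N).
Proof.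
(* [K] bounds both the exponents and the number of parts: neither ['X^(2 ^ K)] nor [P ^+ K] reaches
   degree n + M. [V] below is the truncated geometric series for 1 / (1 - P). *)
case: N => // N _ /=; set M := (2 ^ N)%N; pose K := (n + M).+1.
have M_gt0 : (0 < M)%N by rewrite expn_gt0.
have KM : (n + M < 2 ^ K)%N by apply: ltn_trans (ltn_expl _ _).
pose P := pow2sum K; pose V := \sum_(l < K) P ^+ l.
have VW : V * (1 - P) = 1 - P ^+ K.
  rewrite -[in RHS](expr1n _ K) subrXX mulrC; congr (_ * _).
  by apply: eq_bigr => i _; rewrite expr1n mul1r.
have [E PW] := sqr_pow2sum K; rewrite -/P in PW.
have [c PWM] := expr2X_congr ('X - 'X^(2 ^ K)) E N.
rewrite -PW -/M in PWM.
have key : (V * (P * (1 - P)) ^+ M)`_(n + M)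
    = (P ^+ M * (1 - P) ^+ M.-1)`_(n + M).
  have -> : V * (P * (1 - P)) ^+ M =
     P ^+ M * (1 - P) ^+ M.-1 - P ^+ K * (P ^+ M * (1 - P) ^+ M.-1).
    rewrite exprMn -{2}(prednK M_gt0) exprS.
    have -> : V * (P ^+ M * ((1 - P) * (1 - P) ^+ M.-1))
      = V * (1 - P) * (P ^+ M * (1 - P) ^+ M.-1) by ring.
    by rewrite VW; ring.
  rewrite coefB (coefM (P ^+ K)) [X in _ - X]big1 ?subr0 // => i _.
  by rewrite pow2sum_lowX ?mul0r // ltn_ord.
have vE : (V * 'X^M)`_(n + M) = (v n)%:Z.
  rewrite coefMXn ltnNge leq_addl addnK /= v_sum_ncomp /V coef_sum.
  rewrite /K -addSn big_split_ord /= [X in _ + X]big1 ?addr0.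
    apply: eq_bigr => l _; rewrite coef_pow2sumX //.
    by rewrite (leq_ltn_trans _ KM) ?leq_addr.
  by move=> l _; rewrite pow2sum_lowX // addSn ltnS leq_addr.
(* Replacing X - X ^ (2 ^ K) by X changes the power by a multiple of X ^ (2 ^ K) only. *)
have highE : (V * ('X - 'X^(2 ^ K)) ^+ M)`_(n + M) = (V * 'X^M)`_(n + M).
  have /eqP := subrXX ('X - 'X^(2 ^ K)) ('X : {poly int}) M.
  rewrite subr_eq => /eqP ->; rewrite addrAC subrr add0r mulrDr coefD.
  by rewrite mulNr mulrN mulrCA coefN coefXnM KM oppr0 add0r.
exists (- (V * c)`_(n + M)).
move: key; rewrite PWM mulrDr coefD highE vE mulrnAr coefMn.
move/(canRL (addrK _)) => ->; rewrite mulNrn; congr (_ - _).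
rewrite exprBn prednK // mulr_sumr coef_sum; apply: eq_bigr => i _.
rewrite expr1n mulr1 mulrnAr coefMn mulrCA -exprD; congr (_ *+ _).
by rewrite -polyC1 -polyCN -polyC_exp coefCM coef_pow2sumX.
Qed.

End PowerSeries.

(** * Invariance of [ncomp] under lengthening a run of zeros *)

(* Writing 2 ^ a A - B in binary requires a block of at least a - b ones. *)
Lemma ncomp_below (a b j A B : nat) :
  0 < A -> 0 < B <= 2 ^ b -> b + j < a -> ncomp j (2 ^ a * A - B) = 0%R.
Proof.
move=> A_gt0; elim: a b j B => // a IHa b j B /andP[B_gt0 Bb] bja.
have BX : B <= 2 ^ a * A.
  apply: (leq_trans Bb); rewrite (leq_trans _ (leq_pmulr _ _)) //.
  by rewrite leq_exp2l //; lia.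
rewrite ncomp_rec big1 // => -[z /= zj] /andP[zm even_mz].
suff -> : ncomp (j - z) (2 ^ a.+1 * A - B - z)./2 = 0%R by rewrite mul0rn.
have even_Bz : ~~ odd (B + z).
  by move: even_mz zm BX; rewrite expnS -mulnA; move: (2 ^ a * A) => X; lia.
have -> : (2 ^ a.+1 * A - B - z)./2 = 2 ^ a * A - (B + z)./2.
  by move: even_mz zm; rewrite expnS -mulnA; move: (2 ^ a * A) => X; lia.
case: z => [|z] in even_mz zm zj even_Bz *.
  case: b => [|b] in Bb bja *; first by move: even_Bz Bb; rewrite expn0; lia.
  by apply: (IHa b); move: Bb; rewrite ?expnS; lia.
have b_gt0 : 0 < 2 ^ b by rewrite expn_gt0.
have z_lt := ltn_expl z.+1 (isT : 1 < 2).
(* Using z + 1 parts equal to 1 lowers the number of parts by z + 1 but raises b by z only, which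
   pays for the decrease of a. *)
apply: (IHa (b + z)); last by lia.
have zE : 2 * 2 ^ (b + z) = 2 ^ b * 2 ^ z.+1 by rewrite -expnS -addnS expnD.
by apply/andP; split; nia.
Qed.

(** More than B parts equal to 1 would force a borrow from the upper block; by [ncomp_below] these
    terms vanish, so the recursion sees only B. *)
Lemma ncomp_recB (a j A B : nat) : 0 < A -> j < a.+1 ->
  ncomp j (2 ^ a.+1 * A + B) =
    (\sum_(z < j.+1 | (z <= B)%N && ~~ odd (B - z))
       ncomp (j - z) (2 ^ a * A + (B - z)./2) *+ 'C(j, z))%R.
Proof.
move=> A_gt0 ja; rewrite ncomp_rec big_mkcond [RHS]big_mkcond.
apply: eq_bigr => -[z /= zj] _; rewrite expnS -mulnA.
have [zB|Bz] /= := leqP z B.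
  move: (2 ^ a * A) => X; have -> : z <= 2 * X + B by lia.
  have -> : odd (2 * X + B - z) = odd (B - z) by lia.
  by have -> : (2 * X + B - z)./2 = X + (B - z)./2 by lia.
case: ifP => // /andP[zm even_mz].
have -> : (2 * (2 ^ a * A) + B - z)./2 = 2 ^ a * A - (z - B)./2.
  by move: (2 ^ a * A) zm even_mz => X; lia.
have even_zB : ~~ odd (z - B).
  by move: (2 ^ a * A) zm even_mz => X; lia.
case: z => // z in zj Bz zm even_mz even_zB *.
have z_lt := ltn_expl z.+1 (isT : 1 < 2).
rewrite (@ncomp_below _ z) ?mul0rn //; last by lia.
by move: z_lt; rewrite expnS; lia.
Qed.

(** Both sides follow the same recursion on B by halving; once B = 0, only the term z = 0 remains,
    and it removes one zero from the run. *)
Lemma ncomp_shiftS (a b j A B : nat) :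
  0 < A -> B < 2 ^ b -> b + j < a ->
  ncomp j (2 ^ a.+1 * A + B) = ncomp j (2 ^ a * A + B).
Proof.
move=> A_gt0; elim: b a j B => [|b IHb] a j B Bb bja.
  have -> : B = 0 by move: Bb; rewrite expn0; lia.
  rewrite ncomp_recB //; last by lia.
  rewrite (big_pred1 ord0) /= ?subn0 ?bin0 ?mulr1n ?addn0 //.
  by case=> -[|z] zj.
case: a bja => // a bja.
rewrite !ncomp_recB //; try lia.
apply: eq_bigr => z _; rewrite IHb //; last by lia.
by move: Bb; rewrite expnS; lia.
Qed.

Lemma ncomp_shift (a c b j A B : nat) :
  0 < A -> B < 2 ^ b -> b + j < a -> a <= c ->
  ncomp j (2 ^ c * A + B) = ncomp j (2 ^ a * A + B).
Proof.
move=> A_gt0 Bb bja /subnKC <-.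
elim: (c - a) => [|d IHd]; first by rewrite addn0.
by rewrite addnS (@ncomp_shiftS _ b) //; lia.
Qed.

(** * Binary digit sums and expansions *)

Lemma s2_widen (K m : nat) : m <= K -> s2 m = \sum_(i < K) odd (m %/ 2 ^ i).
Proof.
move=> /subnKC <-; elim: (K - m) => [|d IHd]; first by rewrite addn0.
rewrite addnS big_ord_recr /= -IHd divn_small ?addn0 //.
by apply: leq_trans (ltn_expl m (isT : 1 < 2)) _; rewrite leq_exp2l // leq_addr.
Qed.

Lemma s2_double (m : nat) (b : bool) : s2 (b + m.*2) = b + s2 m.
Proof.
rewrite (@s2_widen (b + m.*2).+1) // (@s2_widen (b + m.*2) m); last by lia.
rewrite big_ord_recl expn0 divn1 oddD odd_double addbF oddb; congr (_ + _).
apply: eq_bigr => i _.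
by rewrite lift0 expnS divnMA divn2 half_bit_double.
Qed.

Lemma s2_half (m : nat) : s2 m = odd m + s2 m./2.
Proof. by rewrite -{1}(odd_double_half m) s2_double. Qed.

Lemma s2_0 : s2 0 = 0. Proof. by rewrite /s2 big_ord0. Qed.

Lemma s2D_pow2 (m q : nat) : s2 (m + 2 ^ q) <= (s2 m).+1.
Proof.
elim: q m => [m|q IHq m]; last first.
  rewrite s2_half (s2_half m).
  have -> : odd (m + 2 ^ q.+1) = odd m by rewrite expnS; lia.
  have -> : (m + 2 ^ q.+1)./2 = m./2 + 2 ^ q by rewrite expnS; lia.
  by have := IHq m./2; lia.
rewrite expn0; elim/ltn_ind: m => m IHm.
have [m_odd|m_even] := boolP (odd m); last first.
  rewrite s2_half (s2_half m).
  have -> : odd (m + 1) by lia.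
  have -> : (m + 1)./2 = m./2 by lia.
  by lia.
rewrite s2_half (s2_half m).
have -> : (m + 1)./2 = m./2 + 1 by lia.
have /IHm : m./2 < m by lia.
by lia.
Qed.

Lemma s2_sum_le (k : seq nat) : s2 (\sum_(j <- k) 2 ^ j) <= size k.
Proof.
elim: k => [|x k IHk]; first by rewrite big_nil s2_0.
by rewrite big_cons addnC (leq_trans (s2D_pow2 _ _)).
Qed.

Lemma ncomp_s2 (j m : nat) : j < s2 m -> ncomp j m = 0%R.
Proof.
(* The truncation order becomes an independent [K], since removing a part changes m alone. *)
rewrite /ncomp; move: {2}m => K; elim: j m => [|j IHj] m.
  by rewrite expr0 coef1; case: m => //; rewrite s2_0.
move=> jm; rewrite exprS {1}/pow2sum mulr_suml coef_sum big1 // => q _.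
rewrite coefXnM; case: ltnP => // qm; apply: IHj.
by have := s2D_pow2 (m - 2 ^ q) q; rewrite subnK // => /(leq_trans jm).
Qed.

Lemma binary_expansion (m : nat) :
  exists k : seq nat,
    [/\ sorted gtn k, size k = s2 m & \sum_(j <- k) 2 ^ j = m].
Proof.
elim/ltn_ind: m => -[|m] IHm.
  by exists [::]; rewrite s2_0 big_nil.
have /IHm[k [k_sorted sz_k sum_k]] : m.+1./2 < m.+1 by lia.
exists ([seq x.+1 | x <- k] ++ nseq (odd m.+1) 0); split.
- case: (odd m.+1) => /=; last by rewrite cats0 sorted_map.
  rewrite cats1; case: k k_sorted {sz_k sum_k} => //= x k k_path.
  by rewrite rcons_path path_map k_path last_map.
- by rewrite size_cat size_map size_nseq sz_k [s2 m.+1]s2_half addnC.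
rewrite big_cat big_map /= -[in RHS](odd_double_half m.+1) addnC; congr (_ + _).
  by rewrite [odd m.+1]/=; case: (~~ odd m) => /=; rewrite ?big_nil // big_seq1.
by rewrite -sum_k -muln2 big_distrl; apply: eq_bigr => i _; rewrite expnSr.
Qed.

(** * Solutions of a system of relations *)

(** Recursive form of [satisfies], suited to simultaneous induction on gaps and exponents. *)
Fixpoint fits (gs : seq shift) (b : shift) (k : seq nat) : bool :=
  match gs, k with
  | [::], [:: x] => holds b x 0
  | g :: gs', x :: ((y :: _) as k') => holds g x y && fits gs' b k'
  | _, _ => false
  end.

Lemma fits_nil (gs : seq shift) (b : shift) : fits gs b [::] = false.
Proof. by case: gs. Qed.

Lemma satisfiesP (R : system) (k : seq nat) :
  satisfies R k <-> fits (gaps R) (bottom R) k.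
Proof.
case: R => gs b; rewrite /satisfies /=.
elim: gs k => [|g gs IHgs] [|x k] /=.
- by split=> // -[].
- by case: k => [|y k] /=; split=> // -[].
- by split=> // -[].
case: k => [|y k]; first by split=> // -[].
split=> [[[sz_k] gaps_k last_k]|/andP[gxy /IHgs[sz_k gaps_k last_k]]].
  rewrite (gaps_k 0) //=; apply/IHgs; split; rewrite /= ?sz_k // => i.
  exact: gaps_k i.+1.
split=> //=; first by rewrite -sz_k.
by case=> //= i; apply: gaps_k.
Qed.

Definition pos_shift (g : shift) : bool := 0 < amount g.

(** The block below such a gap is less than 2 ^ (y + 1), with y its leading exponent, and
    [ncomp_shift] asks for y + 1 + j < y + d. *)
Definition wide (j : nat) (g : shift) : bool :=
  if g is AtLeast d then j.+1 < d else true.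

Lemma holds_amount (g : shift) (x y : nat) : holds g x y -> y + amount g <= x.
Proof. by case: g => d //= /eqP->. Qed.

Lemma fits_sum_lt (gs : seq shift) (b : shift) (x : nat) (s : seq nat) :
  all pos_shift gs -> fits gs b (x :: s) -> \sum_(j <- x :: s) 2 ^ j < 2 ^ x.+1.
Proof.
elim: gs x s => [|g gs IHgs] x [|y s] //=.
  by rewrite big_seq1 ltn_exp2l.
move=> /andP[g_gt0 gs_gt0] /andP[/holds_amount gxy /(IHgs _ _ gs_gt0) sum_lt].
rewrite big_cons expnS mul2n -addnn ltn_add2l (leq_trans sum_lt) //.
by rewrite leq_exp2l //; move: g_gt0; rewrite /pos_shift; lia.
Qed.

(** Exponents are processed from the largest down. [ncomp_shift] shrinks each [AtLeast] gap to its
    minimum; the next exponent is then absorbed into A, which stays common to both sides. *)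
Lemma fits_ncomp (j : nat) (gs : seq shift) (b : shift) :
  all pos_shift gs -> all (wide j) gs -> wide j b ->
  forall (A x x' : nat) (s s' : seq nat), 0 < A ->
    fits gs b (x :: s) -> fits gs b (x' :: s') ->
  ncomp j (2 ^ x * A + \sum_(i <- s) 2 ^ i)
    = ncomp j (2 ^ x' * A + \sum_(i <- s') 2 ^ i).
Proof.
move=> gs_gt0 gs_wide b_wide; elim: gs gs_gt0 gs_wide => [_ _|g gs IHgs] /=.
  move=> A x x' [|//] [|//] A_gt0; rewrite !big_nil.
  case: b b_wide => c /=; first by move=> _ /eqP-> /eqP->.
  move=> jc cx cx'; rewrite (@ncomp_shift c x 0) //; last by lia.
  by rewrite (@ncomp_shift c x' 0) //; lia.
move=> /andP[g_gt0 gs_gt0] /andP[g_wide gs_wide] A x x'.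
move=> [|y s] [|y' s'] A_gt0 //.
suff merge z t u : holds g z t -> fits gs b (t :: u) ->
    ncomp j (2 ^ z * A + \sum_(i <- t :: u) 2 ^ i)
      = ncomp j (2 ^ t * (2 ^ amount g * A + 1) + \sum_(i <- u) 2 ^ i).
  case/andP=> gxy fs /andP[gxy' fs']; rewrite !merge //.
  by apply: IHgs => //; rewrite addn1.
move=> gzt fu.
have -> : 2 ^ t * (2 ^ amount g * A + 1) + \sum_(i <- u) 2 ^ i
    = 2 ^ (t + amount g) * A + \sum_(i <- t :: u) 2 ^ i.
  by rewrite big_cons mulnDr muln1 mulnA -expnD addnA.
case: g g_wide gzt {g_gt0} => d /= jd; first by move/eqP->.
move=> tdz; apply: (@ncomp_shift _ _ t.+1) => //; last by lia.
exact: fits_sum_lt fu.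
Qed.

(* The pointwise smallest solution of a system represents its class. *)
Fixpoint least (gs : seq shift) (b : shift) : seq nat :=
  if gs is g :: gs' then amount g + head 0 (least gs' b) :: least gs' b
  else [:: amount b].

Lemma least_cons (gs : seq shift) (b : shift) :
  exists x s, least gs b = x :: s.
Proof. by case: gs => [|g gs]; do 2!eexists. Qed.

Lemma fits_least (gs : seq shift) (b : shift) : fits gs b (least gs b).
Proof.
elim: gs => [|g gs IHgs] /=; first by case: b => c /=.
have [x [s least_gs]] := least_cons gs b.
rewrite least_gs /= -least_gs IHgs andbT.
by case: g => d /=; rewrite addnC.
Qed.

Lemma least_le (gs : seq shift) (b : shift) (k : seq nat) : fits gs b k ->
  head 0 (least gs b) <= head 0 k
    /\ \sum_(j <- least gs b) 2 ^ j <= \sum_(j <- k) 2 ^ j.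
Proof.
elim: gs k => [|g gs IHgs] [|x [|y k]] //=.
  move=> /holds_amount; rewrite add0n !big_seq1 => bx.
  by rewrite leq_exp2l.
case/andP=> /holds_amount gxy /IHgs /= [head_le sum_le].
have head_le' : amount g + head 0 (least gs b) <= x by lia.
split=> //; rewrite !(big_cons _ _ _ (least _ _)) big_cons /=.
by rewrite leq_add ?leq_exp2l.
Qed.

(** If all relations are equalities, the solution is unique; otherwise an [AtLeast] bound, being
    wide, pushes the leading exponent above j. *)
Lemma least_eq_or_high (j : nat) (gs : seq shift) (b : shift) (k : seq nat) :
  all (wide j) gs -> wide j b -> fits gs b k ->
  least gs b = k \/ j < head 0 (least gs b).
Proof.
move=> gs_wide b_wide; elim: gs k gs_wide => [|g gs IHgs] [|x [|y k]] //=.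
  move=> _; case: b b_wide => c /=; first by move=> _ /eqP->; left.
  by move=> jc _; right; lia.
case/andP=> g_wide gs_wide /andP[gxy /(IHgs _ gs_wide)[least_gs|high]].
  rewrite least_gs /=; case: g g_wide gxy => d /=.
    by move=> _ /eqP->; left; rewrite addnC.
  by move=> jd _; right; lia.
by right; lia.
Qed.

(** * Finitely many systems by truncating gaps *)

Definition clip (D d : nat) : shift := if d < D then Exactly d else AtLeast D.

Lemma holds_clip (D x y : nat) : y <= x -> holds (clip D (minn (x - y) D)) x y.
Proof. by move=> yx; rewrite /clip; case: ifP => /=; lia. Qed.

Lemma wide_clip (i j d : nat) : i <= j -> wide i (clip j.+2 d).
Proof. by rewrite /clip; case: ifP. Qed.

Lemma pos_clip (j d : nat) : pos_shift (clip j.+2 d.+1).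
Proof. by rewrite /pos_shift /clip; case: ifP. Qed.

(* The index d stands for the gap d.+1. *)
Definition clip_system (j : nat) (t : j.-1.-bseq 'I_j.+2 * 'I_j.+3) : system :=
  System [seq clip j.+2 d.+1 | d : 'I_j.+2 <- t.1] (clip j.+2 t.2).

Lemma clip_system_surj (j : nat) (k : seq nat) :
  0 < size k <= j -> sorted gtn k ->
  exists t, satisfies (@clip_system j t) k.
Proof.
case: k => //= x s sj k_path.
pose ds := pairmap (fun y z => inord (minn (y - z) j.+2).-1 : 'I_j.+2) x s.
have ds_size : size ds <= j.-1 by rewrite size_pairmap; lia.
exists (Bseq ds_size, inord (minn (last x s) j.+2)); apply/satisfiesP => /=.
rewrite inordK; last by lia.
clear ds_size sj; rewrite {}/ds; elim: s x k_path => [|y s IHs] x /=.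
  by move=> _; have := @holds_clip j.+2 x 0; rewrite subn0; apply.
case/andP=> yx /IHs ->; rewrite andbT inordK; last by lia.
rewrite prednK; last by lia.
by apply: holds_clip; apply: ltnW.
Qed.

(** * Residues of [v] and the choice of classes *)

Lemma double_half_exp (N : nat) : 0 < N -> 2 ^ N.-1 + 2 ^ N.-1 = 2 ^ N.
Proof. by move=> N_gt0; rewrite addnn -mul2n -expnS prednK. Qed.

(** The congruence involves only part counts 2 ^ N.-1 + i with i < 2 ^ N.-1, all below 2 ^ N. *)
Lemma eq_v_mod (N n n' : nat) : 0 < N ->
  (forall j, j < 2 ^ N -> ncomp j (n + 2 ^ N.-1) = ncomp j (n' + 2 ^ N.-1)) ->
  v n = v n' %[mod 2 ^ N].
Proof.
move=> N_gt0 eq_ncomp; have [c vn] := v_congr_ncomp n N_gt0.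
have [c' vn'] := v_congr_ncomp n' N_gt0.
have vB : ((v n)%:Z = (v n')%:Z + (c - c') *+ (2 ^ N))%R.
  rewrite vn vn' mulrnBl -addrA (addrC (c' *+ _)%R) subrK; congr (_ + _)%R.
  apply: eq_bigr => i _.
  by rewrite eq_ncomp // -(double_half_exp N_gt0) ltn_add2l.
apply/eqP; rewrite -eqz_nat -!modz_nat vB.
by rewrite addrC -mulr_natr natz modzMDl.
Qed.

Lemma dvd_v_s2 (N n : nat) :
  0 < N -> 2 ^ N <= s2 (n + 2 ^ N.-1) -> 2 ^ N %| v n.
Proof.
move=> N_gt0 s2_ge; have [c] := v_congr_ncomp n N_gt0.
rewrite big1 ?add0r => [vn|i _]; last first.
  rewrite ncomp_s2 ?mulr0 ?mul0rn // (leq_trans _ s2_ge) //.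
  by rewrite -(double_half_exp N_gt0) ltn_add2l.
have : (Posz (2 ^ N) %| Posz (v n))%Z.
  by rewrite vn -mulr_natr natz dvdz_mull.
by rewrite dvdzE.
Qed.

Theorem theorem3 (N : nat) (N_gt0 : 0 < N) :
  exists (m : nat) (R : 'I_m -> system) (res : system -> 'I_(2 ^ N)),
    [/\ forall i : 'I_m, admissible (R i),
        forall (i : 'I_m) (n : nat), in_class N (R i) n ->
          [/\ 0 < n, s2 (n + 2 ^ N.-1) < 2 ^ N & v n %% 2 ^ N = res (R i)]
      & forall n : nat, 0 < n -> (forall i : 'I_m, ~ in_class N (R i) n) ->
          2 ^ N %| v n].
Proof.
(* [J] bounds both the number of parts and the number of exponents; truncation at [J.+2] makes every
   gap wide for all j <= J. *)
pose J := (2 ^ N).-1; pose T := (J.-1.-bseq 'I_J.+2 * 'I_J.+3)%type.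
have JE : 2 ^ N = J.+1 by rewrite prednK // expn_gt0.
have NJ : N <= J by rewrite -ltnS -JE ltn_expl.
pose low (Q : system) := \sum_(j <- least (gaps Q) (bottom Q)) 2 ^ j.
(* Only systems whose least value exceeds 2 ^ N.-1 are kept, so that all their elements are
   positive. *)
pose S := {t : T | 2 ^ N.-1 < low (clip_system t)}.
pose R (i : 'I_#|{: S}|) := clip_system (val (enum_val i)).
(* The residue of a class is read off at its least element. *)
have res_lt (Q : system) : v (low Q - 2 ^ N.-1) %% 2 ^ N < 2 ^ N.
  by rewrite ltn_pmod ?expn_gt0.
have sys_pos (t : T) : all pos_shift (gaps (clip_system t)).
  by rewrite all_map; apply/allP => d _; apply: pos_clip.
have sys_wide (t : T) j : j <= J -> all (wide j) (gaps (clip_system t)).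
  by move=> jJ; rewrite all_map; apply/allP => d _; apply: wide_clip.
exists #|{: S}|, R, (fun Q => Ordinal (res_lt Q)); split.
- by move=> i; apply: sys_pos.
- move=> i n [k /satisfiesP k_fits ->]; move: k_fits.
  rewrite /R; case: (enum_val i) => t t_low /= k_fits.
  have [_ low_le] := least_le k_fits.
  have k_gt : 2 ^ N.-1 < \sum_(j <- k) 2 ^ j := leq_trans t_low low_le.
  have k_size : size k <= J.
    have [-> _ _] : satisfies (clip_system t) k by apply/satisfiesP.
    rewrite size_map -ltnS; have := size_bseq t.1; rewrite -ltnS prednK //.
    exact: leq_trans NJ.
  split; first by rewrite subn_gt0.
    by rewrite subnK ?(ltnW k_gt) // JE ltnS (leq_trans (s2_sum_le k)).
  apply: eq_v_mod => // j jN; rewrite !subnK ?(ltnW k_gt) ?(ltnW t_low) //.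
  have jJ : j <= J by rewrite -ltnS -JE.
  pose Q := clip_system t; have := fits_least (gaps Q) (bottom Q).
  rewrite /low -/Q; have [x [s ->]] := least_cons (gaps Q) (bottom Q).
  case: k k_fits {low_le k_gt k_size} => [|y k] k_fits s_fits.
    by rewrite fits_nil in k_fits.
  (* The leading power of 2 is the upper block, with A = 1. *)
  rewrite !big_cons -[2 ^ y]muln1 -[2 ^ x]muln1.
  have t_wide := wide_clip t.2 jJ.
  by apply: (fits_ncomp (sys_pos t) (sys_wide t j jJ) t_wide) k_fits s_fits.
move=> n n_gt0 n_out.
have [s2_lt|] := ltnP (s2 (n + 2 ^ N.-1)) (2 ^ N); last exact: dvd_v_s2.
have [k [k_sorted k_size k_sum]] := binary_expansion (n + 2 ^ N.-1).
have k_gt0 : 0 < size k.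
  by case: k k_sum {k_sorted k_size}; rewrite ?big_nil //; lia.
have k_le : size k <= J by rewrite k_size -ltnS -JE.
have [|t t_k] := @clip_system_surj J k _ k_sorted; first by rewrite k_gt0.
(* The system found for n is among those kept: its least solution is either k itself, with value n +
   2 ^ N.-1, or has leading exponent above J >= N. *)
have t_low : 2 ^ N.-1 < low (clip_system t).
  have /satisfiesP k_fits := t_k; rewrite /low.
  have [||->|high] := @least_eq_or_high J _ _ _ _ _ k_fits.
  - exact: sys_wide.
  - exact: wide_clip.
  - by rewrite k_sum; lia.
  pose Q := clip_system t; rewrite -/Q in high *; move: high.
  have [x [s ->]] := least_cons (gaps Q) (bottom Q); rewrite big_cons /= => Jx.
  by rewrite ltn_addr // ltn_exp2l //; lia.
case: (n_out (enum_rank (exist _ t t_low : S))); exists k.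
  by rewrite /R enum_rankK.
by rewrite k_sum addnK.
Qed.
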